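(* Let $p\ge2$, let $\boldsymbol{S}$ be a $p\times p$ symmetric positive semidefinite matrix, let $\rho>0$ be fixed and $k$ an integer with $0\le k\le\binom p2$. Let $\mathcal{C}=\{\boldsymbol{A}\in\mathbb{R}^{p\times p}:\boldsymbol{A}=\boldsymbol{A}^T,\ \|\boldsymbol{A}\|_0\le 2k+p\}$ and define $h_\rho(\boldsymbol{\Sigma})=\ln\det\boldsymbol{\Sigma}+\mathrm{tr}(\boldsymbol{\Sigma}^{-1}\boldsymbol{S})+\frac\rho2\mathrm{dist}(\boldsymbol{\Sigma},\mathcal{C})^2$ for $\boldsymbol{\Sigma}\succ\boldsymbol{0}$ and $h_\rho(\boldsymbol{\Sigma})=+\infty$ otherwise. Given $\boldsymbol{\Sigma}_0$, generate $\boldsymbol{\Sigma}_{k+1}=\boldsymbol{\Sigma}_k+\eta_k\boldsymbol{v}_k$ as follows: pick any $\boldsymbol{\Theta}_k\in P_{\mathcal{C}}(\boldsymbol{\Sigma}_k)$, let $\widehat{\boldsymbol{\Sigma}}_k$ be the unique solution of $\rho\widehat{\boldsymbol{\Sigma}}_k+\boldsymbol{\Sigma}_k^{-1}\widehat{\boldsymbol{\Sigma}}_k\boldsymbol{\Sigma}_k^{-1}=\rho\boldsymbol{\Theta}_k+\boldsymbol{\Sigma}_k^{-1}\boldsymbol{S}\boldsymbol{\Sigma}_k^{-1}$, set $\boldsymbol{v}_k=\widehat{\boldsymbol{\Sigma}}_k-\boldsymbol{\Sigma}_k$, and $\eta_k\in\mathrm{argmin}_{\eta\in[0,1]}h_\rho(\boldsymbol{\Sigma}_k+\eta\boldsymbol{v}_k)$.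 If $\boldsymbol{\Sigma}_0$ is positive definite and $\boldsymbol{S}$ is nonsingular, then the sequence $(\boldsymbol{\Sigma}_k)$ is bounded and lies in the interior of the positive definite cone, and every limit point $\boldsymbol{\Sigma}$ of the sequence is a stationary point of $h_\rho$, i.e. satisfies $\boldsymbol{\Sigma}^{-1}-\boldsymbol{\Sigma}^{-1}\boldsymbol{S}\boldsymbol{\Sigma}^{-1}+\rho(\boldsymbol{\Sigma}-\boldsymbol{\Theta})=\boldsymbol{0}$ for some $\boldsymbol{\Theta}\in P_{\mathcal{C}}(\boldsymbol{\Sigma})$.
   Context: $\|\boldsymbol{A}\|_0$ is the number of nonzero entries of $\boldsymbol{A}$; $\mathrm{dist}$ is Frobenius distance. $P_{\mathcal{C}}(\boldsymbol{\Sigma})$ denotes the (possibly multi-valued) set of Frobenius-nearest points of $\mathcal{C}$ to $\boldsymbol{\Sigma}$. The choice of $\boldsymbol{\Theta}_k$ within $P_{\mathcal{C}}(\boldsymbol{\Sigma}_k)$ is arbitrary, so the iteration is a set-valued algorithm map. *)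

(* Defs.v *)
From HB Require Import structures.
From mathcomp Require Import all_boot all_order all_algebra.
From mathcomp Require Import all_classical all_reals all_analysis.
Set Implicit Arguments. Unset Strict Implicit. Unset Printing Implicit Defensive.
Import Order.TTheory GRing.Theory Num.Theory.
Local Open Scope classical_set_scope.
Local Open Scope ring_scope.

Section Defs.
Variables (R : realType) (p : nat).
Notation M := 'M[R]_p.

Definition symmx (A : M) : Prop := A^T = A.
Definition psdmx (A : M) : Prop :=
  symmx A /\ forall v : 'cV[R]_p, 0 <= (v^T *m A *m v) 0 0.
Definition pdmx (A : M) : Prop :=
  symmx A /\ forall v : 'cV[R]_p, v != 0 -> 0 < (v^T *m A *m v) 0 0.

Definition nnz (A : M) : nat := #|[set ij : 'I_p * 'I_p | A ij.1 ij.2 != 0]|.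

Definition frob (A : M) : R := Num.sqrt (\sum_i \sum_j A i j ^+ 2).
Definition fdist (A B : M) : R := frob (A - B).

Definition Cset (k : nat) : set M := [set A | symmx A /\ (nnz A <= 2 * k + p)%N].

Definition distC (k : nat) (Sig : M) : R := inf [set fdist Sig A | A in Cset k].

Definition projC (k : nat) (Sig : M) : set M :=
  [set Th | Cset k Th /\ forall A, Cset k A -> fdist Sig Th <= fdist Sig A].

Definition h_rho (S : M) (rho : R) (k : nat) (Sig : M) : \bar R :=
  if `[< pdmx Sig >] then
    (ln (\det Sig) + \tr (invmx Sig *m S) + rho / 2 * distC k Sig ^+ 2)%:E
  else +oo%E.

Definition alg_step (S : M) (rho : R) (k : nat) (Sig Sig' : M) : Prop :=
  exists Th, exists Sh, exists eta : R,
    [/\ projC k Sig Th,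
        rho *: Sh + invmx Sig *m Sh *m invmx Sig
          = rho *: Th + invmx Sig *m S *m invmx Sig,
        (0 <= eta <= 1),
        (forall e : R, 0 <= e <= 1 ->
           (h_rho S rho k (Sig + eta *: (Sh - Sig))
             <= h_rho S rho k (Sig + e *: (Sh - Sig)))%E)
      & Sig' = Sig + eta *: (Sh - Sig)].

Definition seq_limit_point (Sq : nat -> M) (L : M) : Prop :=
  forall eps : R, 0 < eps -> forall N : nat, exists2 n : nat, (N <= n)%N & fdist (Sq n) L < eps.

Definition stationary (S : M) (rho : R) (k : nat) (Sig : M) : Prop :=
  pdmx Sig /\ exists2 Th, projC k Sig Th &
    invmx Sig - invmx Sig *m S *m invmx Sig + rho *: (Sig - Th) = 0.

End Defs.

(* Main.v *)
Require Import Defs.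
From HB Require Import structures.
From mathcomp Require Import all_boot all_order all_algebra.
From mathcomp Require Import all_classical all_reals all_analysis.
From mathcomp Require Import perm ring lra.
Set Implicit Arguments.
Unset Strict Implicit.
Unset Printing Implicit Defensive.
Import Order.TTheory GRing.Theory Num.Theory.
Import numFieldNormedType.Exports.
Local Open Scope classical_set_scope.
Local Open Scope ring_scope.

(* The penalty [rho / 2 * dist(Sig, C)^2] is majorized by
   [rho / 2 * |Sig - Th|^2] with equality at the current iterate, and [v] is a
   descent direction of this majorant. On the sublevel set of the initial value
   the iterates and their inverses are bounded (as S is positive definite), which
   gives a fixed step size for which h decreases by at least a constant times
   [|v|^2]. The exact line search does at least as well and h is bounded below,
   so [v_n -> 0]. Multiplying the equation defining [v_n] on both sides by
   [Sig_n] makes it polynomial in [Sig_n], [Th_n] and [v_n]. Since [Th_n] is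
   obtained from [Sig_n] by zeroing entries outside one of finitely many
   supports, the support can be fixed along a subsequence converging to a given
   limit point, and the equation passes to the limit. *)

(** * Frobenius norm *)

Section Norm.
Variable R : realType.
Implicit Types m n q : nat.

Definition mxdot m n (A B : 'M[R]_(m, n)) : R := \tr (A^T *m B).
Definition sqnorm m n (A : 'M[R]_(m, n)) : R := mxdot A A.

Lemma mxdotE m n (A B : 'M[R]_(m, n)) :
  mxdot A B = \sum_i \sum_j A i j * B i j.
Proof.
rewrite /mxdot /mxtrace exchange_big /=; apply: eq_bigr => j _.
by rewrite mxE; apply: eq_bigr => i _; rewrite mxE.
Qed.

Lemma sqnormE m n (A : 'M[R]_(m, n)) : sqnorm A = \sum_i \sum_j A i j ^+ 2.
Proof. by rewrite /sqnorm mxdotE; apply: eq_bigr => i _; apply: eq_bigr => j _; rewrite expr2. Qed.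

Lemma mxdotC m n (A B : 'M[R]_(m, n)) : mxdot A B = mxdot B A.
Proof. by rewrite /mxdot -mxtrace_tr trmx_mul trmxK. Qed.

Lemma mxdotDr m n (A B C : 'M[R]_(m, n)) : mxdot A (B + C) = mxdot A B + mxdot A C.
Proof. by rewrite /mxdot mulmxDr mxtraceD. Qed.

Lemma mxdotZr m n a (A B : 'M[R]_(m, n)) : mxdot A (a *: B) = a * mxdot A B.
Proof. by rewrite /mxdot -scalemxAr mxtraceZ. Qed.

Lemma sqnormD m n a (A B : 'M[R]_(m, n)) :
  sqnorm (A + a *: B) = sqnorm A + 2 * a * mxdot A B + a ^+ 2 * sqnorm B.
Proof.
rewrite /sqnorm mxdotDr mxdotZr ![mxdot (_ + _) _]mxdotC !mxdotDr !mxdotZr.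
rewrite [mxdot B A]mxdotC; ring.
Qed.

Lemma sqnorm_ge0 m n (A : 'M[R]_(m, n)) : 0 <= sqnorm A.
Proof. by rewrite sqnormE; apply: sumr_ge0 => i _; apply: sumr_ge0 => j _; apply: sqr_ge0. Qed.

Lemma sqr_entry_le_sqnorm m n (A : 'M[R]_(m, n)) i j : A i j ^+ 2 <= sqnorm A.
Proof.
rewrite sqnormE (bigD1 i) //= (bigD1 j) //= -addrA lerDl addr_ge0 //.
  by apply: sumr_ge0 => k _; apply: sqr_ge0.
by apply: sumr_ge0 => k _; apply: sumr_ge0 => l _; apply: sqr_ge0.
Qed.

Lemma sqnorm_eq0 m n (A : 'M[R]_(m, n)) : sqnorm A <= 0 -> A = 0.
Proof.
move=> A0; apply/matrixP => i j; rewrite mxE; apply/eqP.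
by rewrite -sqrf_eq0 eq_le sqr_ge0 andbT (le_trans (sqr_entry_le_sqnorm _ i j)).
Qed.

Lemma sqnorm_tr m n (A : 'M[R]_(m, n)) : sqnorm A^T = sqnorm A.
Proof. by rewrite /sqnorm /mxdot trmxK mxtrace_mulC. Qed.

(** Young's inequality, from expanding [|A - B / (2 a)|^2 >= 0]. *)
Lemma mxdot_le m n a (A B : 'M[R]_(m, n)) : 0 < a ->
  mxdot A B <= a * sqnorm A + (4 * a)^-1 * sqnorm B.
Proof.
move=> a0; have := sqnorm_ge0 (A + (- (2 * a)^-1) *: B); rewrite sqnormD => h.
have := mulr_ge0 (ltW a0) h.
have -> : a * (sqnorm A + 2 * - (2 * a)^-1 * mxdot A B + (- (2 * a)^-1) ^+ 2 * sqnorm B)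
  = a * sqnorm A - mxdot A B + (4 * a)^-1 * sqnorm B by field; lra.
lra.
Qed.

(** Lagrange's identity: the double sum of [(a_i b_j - a_j b_i)^2] is twice the gap between the two
    sides. *)
Lemma sum_cauchy_schwarz n (a b : 'I_n -> R) :
  (\sum_i a i * b i) ^+ 2 <= (\sum_i a i ^+ 2) * (\sum_i b i ^+ 2).
Proof.
have : 0 <= \sum_i \sum_j (a i * b j - a j * b i) ^+ 2.
  by apply: sumr_ge0 => i _; apply: sumr_ge0 => j _; apply: sqr_ge0.
have -> : \sum_i \sum_j (a i * b j - a j * b i) ^+ 2 =
  \sum_i \sum_j a i ^+ 2 * b j ^+ 2 + \sum_i \sum_j b i ^+ 2 * a j ^+ 2
   - 2 * \sum_i \sum_j (a i * b i) * (a j * b j).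
  rewrite mulr_sumr -big_split -sumrB /=; apply: eq_bigr => i _.
  rewrite mulr_sumr -big_split -sumrB /=; apply: eq_bigr => j _; ring.
rewrite -!big_distrlr /=; nra.
Qed.

Lemma sqnormM m n q (A : 'M[R]_(m, n)) (B : 'M[R]_(n, q)) :
  sqnorm (A *m B) <= sqnorm A * sqnorm B.
Proof.
rewrite -(sqnorm_tr B) !sqnormE big_distrlr /=.
apply: ler_sum => i _; apply: ler_sum => j _; rewrite mxE.
apply: le_trans (sum_cauchy_schwarz _ _) _.
by rewrite ler_wpM2l ?sumr_ge0 // => [k _|]; rewrite ?sqr_ge0//; apply: ler_sum => k _; rewrite mxE.
Qed.

Lemma frobE p (A : 'M[R]_p) : frob A = Num.sqrt (sqnorm A).
Proof. by rewrite sqnormE. Qed.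

End Norm.

(** * Positive definite matrices *)

Section PD.
Variable R : realType.

Lemma trmxZ m n (a : R) (A : 'M[R]_(m, n)) : (a *: A)^T = a *: A^T.
Proof. exact: linearZ. Qed.

Lemma pdmx_congr m n (A : 'M[R]_m) (P : 'M[R]_(m, n)) :
  pdmx A -> (forall x : 'cV_n, x != 0 -> P *m x != 0) -> pdmx (P^T *m A *m P).
Proof.
move=> [sA pA] injP; split.
  by rewrite /symmx !trmx_mul trmxK sA mulmxA.
move=> x /injP/pA; rewrite trmx_mul !mulmxA; exact.
Qed.

Lemma unitmx_inj n q (P : 'M[R]_n) (x : 'M[R]_(n, q)) : (P \in unitmx) -> x != 0 -> P *m x != 0.
Proof.
move=> uP; apply: contra_neq => Px0.
by rewrite -(mulKmx uP x) Px0 mulmx0.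
Qed.

(* Cholesky factorization and the concavity bound [ln det A <= tr (A - I)] come
   out of the same induction on Schur complements. *)
Lemma pdmx_gram n (A : 'M[R]_n) : pdmx A ->
  exists2 B : 'M[R]_n, A = B^T *m B & 0 < \det A /\ ln (\det A) <= \tr A - n%:R.
Proof.
elim: n A => [|n IHn] A pA.
  exists 0; first by rewrite [A]flatmx0 [RHS]flatmx0.
  by rewrite det_mx00 ln1 /mxtrace big_ord0 subrr.
have nS : n.+1%:R = 1 + n%:R :> R by rewrite -natr1 addrC.
change ('M[R]_(1 + n)) in A; change (@pdmx R (1 + n) A) in pA.
have [sA pA'] := pA.
pose a := ulsubmx A; pose b := ursubmx A; pose C := drsubmx A.
pose a0 := a 0 0.
have aE : a = a0%:M by rewrite [a]mx11_scalar.
have dlE : dlsubmx A = b^T by rewrite trmx_ursub sA.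
have AE : A = block_mx a0%:M b b^T C by rewrite -aE -dlE submxK.
have sC : C^T = C by rewrite trmx_drsub sA.
have a0_gt0 : 0 < a0.
  pose e : 'cV[R]_(1 + n) := col_mx 1%:M 0.
  have /pA' : e != 0.
    apply/eqP => /(congr1 usubmx); rewrite col_mxKu linear0 => /matrixP/(_ 0 0).
    by rewrite !mxE => /eqP; rewrite oner_eq0.
  rewrite AE tr_col_mx mul_row_block mul_row_col !trmx0 !mul0mx !mulmx0 !addr0.
  by rewrite trmx1 mul1mx mulmx1 mxE mulr1n.
(* The columns of [P] are [A]-orthogonal to the first basis vector, so the Schur complement [C'] is
   [P^T A P] and inherits positivity by congruence. *)
pose P : 'M[R]_(1 + n, n) := col_mx (- a0^-1 *: b) 1%:M.
pose C' := C - a0^-1 *: (b^T *m b).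
have C'E : C' = P^T *m A *m P.
  rewrite AE tr_col_mx mul_row_block mul_row_col trmx1 !mul1mx !mulmx1.
  rewrite trmxZ mul_mx_scalar scalerA mulrN mulfV ?gt_eqF // scaleN1r addNr.
  by rewrite mul0mx add0r -scalemxAl scaleNr addrC.
have pC' : pdmx C'.
  rewrite C'E; apply: pdmx_congr => // x x0; apply: contra_neq x0 => Px.
  by move: Px; rewrite mul_col_mx mul1mx => /(congr1 dsubmx); rewrite col_mxKd linear0.
have [B' C'B [dC' lC']] := IHn _ pC'.
pose B : 'M[R]_(1 + n) := block_mx (Num.sqrt a0)%:M ((Num.sqrt a0 / a0) *: b) 0 B'.
have sqa : Num.sqrt a0 * Num.sqrt a0 = a0 by rewrite -expr2 sqr_sqrtr // ltW.
have AB : A = B^T *m B.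
  rewrite AE tr_block_mx mulmx_block !trmx0 !mulmx0 !mul0mx !addr0 tr_scalar_mx.
  rewrite -scalar_mxM -C'B trmxZ mul_mx_scalar mul_scalar_mx.
  rewrite -scalemxAl -scalemxAr !scalerA !mulrA sqa mulfV ?gt_eqF // !scale1r.
  have -> : Num.sqrt a0 / a0 * Num.sqrt a0 = 1.
    by rewrite mulrAC sqa mulfV // gt_eqF.
  by rewrite mul1r addrC subrK.
have dA : \det A = a0 * \det C'.
  rewrite AB C'B !det_mulmx !det_tr det_ublock det_scalar1 -{3}sqa; ring.
exists B => //; split; first by rewrite dA mulr_gt0.
rewrite dA lnM ?posrE //.
have trA : \tr A = a0 + \tr C by rewrite AE mxtrace_block /mxtrace big_ord1 mxE mulr1n.
have trC : \tr C' <= \tr C.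
  rewrite /C' raddfB /= mxtraceZ gerDl oppr_le0 mulr_ge0 ?invr_ge0 ?(ltW a0_gt0) //.
  exact: (sqnorm_ge0 b).
have : ln (1 + (a0 - 1)) <= a0 - 1 by apply: le_ln1Dx; lra.
rewrite addrCA subrr addr0 trA nS; lra.
Qed.

Lemma sqnorm_cV n (x : 'cV[R]_n) : sqnorm x = (x^T *m x) 0 0.
Proof. exact: trace_mx11. Qed.

Lemma sqnorm_gt0 m n (A : 'M[R]_(m, n)) : A != 0 -> 0 < sqnorm A.
Proof. by move=> A0; rewrite ltNge; apply: contra_neqN A0; apply: sqnorm_eq0. Qed.

Lemma sqnorm1 n : sqnorm (1%:M : 'M[R]_n) = n%:R.
Proof. by rewrite /sqnorm /mxdot trmx1 mulmx1 mxtrace1. Qed.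

Lemma pdmx_unit n (A : 'M[R]_n) : pdmx A -> A \in unitmx.
Proof. by move=> /pdmx_gram[B _ [d0 _]]; rewrite unitmxE unitfE gt_eqF. Qed.

(** If the form vanished at some [x != 0], then at [x + t A x] it would equal
    [2 t |A x|^2 + O(t^2)], which is negative for a small [t < 0] because [A x != 0]. *)
Lemma psdmx_unit_pdmx n (A : 'M[R]_n) : psdmx A -> A \in unitmx -> pdmx A.
Proof.
move=> [sA pA] uA; split=> // x x0; rewrite lt_neqAle pA andbT eq_sym.
apply/negP => /eqP xAx0.
pose w := A *m x.
have a0 : 0 < sqnorm w by apply: sqnorm_gt0; apply: unitmx_inj.
pose b := (w^T *m A *m w) 0 0.
have b0 : 0 <= b := pA w.
(* The minimizer in [t] has denominator [b]; taking [b + 1] also covers [b = 0]. *)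
pose t := - (sqnorm w / (b + 1)).
have := pA (x + t *: w).
have -> : ((x + t *: w)^T *m A *m (x + t *: w)) 0 0 = 2 * t * sqnorm w + t ^+ 2 * b.
  rewrite [(x + _)^T]linearD /= trmxZ !mulmxDl !mulmxDr -!scalemxAl -!scalemxAr.
  have e1 : x^T *m A *m w = w^T *m w by rewrite /w trmx_mul sA.
  have e2 : w^T *m A *m x = w^T *m w by rewrite -mulmxA.
  rewrite e1 e2 [LHS]mxE [X in X + _]mxE xAx0 [X in _ + X]mxE !mxE.
  rewrite /b !mxE sqnorm_cV !mxE; ring.
have -> : 2 * t * sqnorm w + t ^+ 2 * b
  = - (sqnorm w ^+ 2 * (b + 2) / (b + 1) ^+ 2) by rewrite /t; field; lra.
rewrite oppr_ge0 leNgt divr_gt0 //; first by rewrite mulr_gt0 ?exprn_gt0 //; lra.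
by rewrite exprn_gt0 //; lra.
Qed.

Lemma mxtrace_conj_le m n c (Y : 'M[R]_(m, n)) (A : 'M[R]_n) :
  (forall y : 'cV_n, (y^T *m A *m y) 0 0 <= c * sqnorm y) ->
  \tr (Y *m A *m Y^T) <= c * sqnorm Y.
Proof.
move=> hA; rewrite sqnormE mulr_sumr; apply: ler_sum => i _.
have := hA (col i Y^T); rewrite tr_col trmxK -row_mul -mulmxA.
have -> : c * sqnorm (col i Y^T) = c * \sum_j Y i j ^+ 2.
  rewrite -sqnorm_tr tr_col trmxK sqnormE big_ord1; congr (_ * _).
  by apply: eq_bigr => j _; rewrite mxE.
apply: le_trans; rewrite mulmxA -row_mul !mxE le_eqVlt; apply/orP; left; apply/eqP.
by apply: eq_bigr => j _; rewrite !mxE.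
Qed.

(** Inversion reverses the order of forms: [N >= 1/2] gives [N^-1 <= 2]. It follows from
    [|y - x / 2|^2 >= 0] at [x = N^-1 y]. *)
Lemma invmx_form_le n (N : 'M[R]_n) : symmx N -> N \in unitmx ->
  (forall x : 'cV_n, sqnorm x <= 2 * (x^T *m N *m x) 0 0) ->
  forall y : 'cV_n, (y^T *m invmx N *m y) 0 0 <= 2 * sqnorm y.
Proof.
move=> sN uN hN y; pose x := invmx N *m y.
have yE : y = N *m x by rewrite /x mulKVmx.
have e : y^T *m invmx N *m y = x^T *m N *m x.
  by rewrite {1}yE trmx_mul sN -!mulmxA -/x.
have dE : mxdot y x = (x^T *m N *m x) 0 0.
  by rewrite mxdotC yE /mxdot trace_mx11 mulmxA.
have := sqnorm_ge0 (y + (- 2^-1) *: x); rewrite sqnormD dE e.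
have := hN x; lra.
Qed.

(** Since [|eta X| <= 1/2], the perturbation takes away at most half of the identity form. *)
Lemma pdmx_near1 n (X : 'M[R]_n) eta : symmx X -> eta ^+ 2 * sqnorm X <= 4^-1 ->
  pdmx (1%:M + eta *: X) /\
  forall x : 'cV_n, sqnorm x <= 2 * (x^T *m (1%:M + eta *: X) *m x) 0 0.
Proof.
move=> sX hX.
have h (x : 'cV[R]_n) : sqnorm x <= 2 * (x^T *m (1%:M + eta *: X) *m x) 0 0.
  have -> : (x^T *m (1%:M + eta *: X) *m x) 0 0 = sqnorm x + eta * mxdot x (X *m x).
    by rewrite mulmxDr mulmxDl mulmx1 mxE -sqnorm_cV -scalemxAr -scalemxAl mxE /mxdot trace_mx11 mulmxA.
  have := sqnorm_ge0 (x + (2 * eta) *: (X *m x)); rewrite sqnormD.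
  have : sqnorm (X *m x) <= sqnorm X * sqnorm x by exact: sqnormM.
  have := sqnorm_ge0 x; have := sqnorm_ge0 X; have := sqr_ge0 eta; nra.
split=> //; split.
  by rewrite /symmx linearD /= trmx1 trmxZ sX.
by move=> x /sqnorm_gt0 x0; have := h x; lra.
Qed.

(** The expansion [N^-1 = 1 - eta X + eta^2 X N^-1 X] is exact for [N = 1 + eta X], and [N^-1 <= 2]
    bounds its last term. *)
Lemma mxtrace_inv_near1_le m n (X : 'M[R]_n) (F : 'M[R]_(m, n)) eta :
  symmx X -> eta ^+ 2 * sqnorm X <= 4^-1 ->
  \tr (F *m invmx (1%:M + eta *: X) *m F^T) <=
    sqnorm F - eta * \tr (F *m X *m F^T) + 2 * eta ^+ 2 * sqnorm (F *m X).
Proof.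
move=> sX hX; have [pN hN] := pdmx_near1 sX hX.
set N := 1%:M + eta *: X in pN hN *.
have uN := pdmx_unit pN; have sN := pN.1.
have NX : N *m X = X *m N by rewrite /N mulmxDr mulmxDl mulmx1 mul1mx -scalemxAr -scalemxAl.
have e : invmx N = 1%:M - eta *: X + eta ^+ 2 *: (X *m invmx N *m X).
  apply: (can_inj (mulKmx uN)); rewrite mulmxV // mulmxDr -scalemxAr !mulmxA NX.
  rewrite mulmxK // mulmxBr mulmx1 -scalemxAr NX /N mulmxDr mulmx1 -scalemxAr.
  rewrite scalerDr scalerA -expr2 opprD addrA addrK subrK //.
have -> : F *m invmx N *m F^T = F *m F^T - eta *: (F *m X *m F^T)
   + eta ^+ 2 *: ((F *m X) *m invmx N *m (F *m X)^T).
  rewrite trmx_mul sX {1}e mulmxDr mulmxBr mulmx1 mulmxDl mulmxBl.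
  by rewrite -!scalemxAr -!scalemxAl !mulmxA.
rewrite mxtraceD raddfB /= !mxtraceZ -(sqnorm_tr F) /sqnorm /mxdot trmxK.
have := mxtrace_conj_le (F *m X) (invmx_form_le sN uN hN).
rewrite /sqnorm /mxdot; have := sqr_ge0 eta; nra.
Qed.

End PD.

(** * Descent of the majorant *)

Section Descent.
Variable R : realType.

(** The smooth part of [h_rho]: the Gaussian negative log-likelihood up to scale and an additive
    constant. *)
Definition loglik n (S A : 'M[R]_n) : R := ln (\det A) + \tr (invmx A *m S).

Lemma invmx_gram n (B : 'M[R]_n) : B \in unitmx ->
  invmx (B^T *m B) = invmx B *m (invmx B)^T.
Proof.
move=> uB.
have uA : B^T *m B \in unitmx by rewrite unitmx_mul unitmx_tr uB.
apply: (can_inj (mulKmx uA)); rewrite mulmxV // mulmxA mulmxK //.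
by rewrite trmx_inv mulmxV ?unitmx_tr.
Qed.

Lemma pdmx_gram_unit n (A : 'M[R]_n) : pdmx A ->
  exists2 B : 'M[R]_n, B \in unitmx & A = B^T *m B.
Proof.
move=> pA; have uA := pdmx_unit pA; have [B AB _] := pdmx_gram pA.
by exists B => //; move: uA; rewrite AB unitmx_mul => /andP[].
Qed.

(* Everything is expressed through the congruent direction [X = Z^T v Z], where
   [Sg^-1 = Z Z^T]: then [D = rho |v|^2 + |X|^2] is minus the slope of the
   majorant along [v], and it also dominates its second-order remainder, so that
   a step size depending only on [tau] and [d] decreases the majorant. *)
Lemma loglik_descent n (Sg v E Th : 'M[R]_n) rho eta :
  let W := invmx Sg in let S := E^T *m E in
  let tau := \tr (W *m S) in let d := sqnorm (Sg - Th) in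
  pdmx Sg -> symmx v -> 0 < rho -> 0 <= eta ->
  rho *: v + W *m v *m W = - (W - W *m S *m W + rho *: (Sg - Th)) ->
  eta ^+ 2 * (2 * n%:R + 2 * tau ^+ 2 + rho * d) <= 4^-1 ->
  eta * (2 * tau + 1) <= 2^-1 ->
  pdmx (Sg + eta *: v) /\
    loglik S (Sg + eta *: v) + rho / 2 * sqnorm (Sg + eta *: v - Th) <=
    loglik S Sg + rho / 2 * d - eta / 2 * rho * sqnorm v.
Proof.
move=> W S tau d pSg sv rho0 eta0 eqv he1 he2.
have [B uB SgB] := pdmx_gram_unit pSg.
pose Z := invmx B.
have uZ : Z \in unitmx by rewrite unitmx_inv.
have WZ : W = Z *m Z^T by rewrite /W SgB invmx_gram.
pose X := Z^T *m v *m Z; pose F := E *m Z.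
have sX : symmx X by rewrite /symmx /X !trmx_mul trmxK sv mulmxA.
have tauF : tau = sqnorm F.
  by rewrite /tau /sqnorm /mxdot /F /S WZ trmx_mul !mulmxA [RHS]mxtrace_mulC !mulmxA.
have tau0 : 0 <= tau by rewrite tauF sqnorm_ge0.
pose D := rho * sqnorm v + sqnorm X.
have eD : mxdot v (rho *: v + W *m v *m W) = D.
  rewrite mxdotDr mxdotZr /D; congr (_ + _).
  by rewrite /sqnorm /mxdot sv sX WZ /X !mulmxA mxtrace_mulC !mulmxA.
have e1 : mxdot v W = \tr X.
  by rewrite /mxdot sv WZ /X !mulmxA mxtrace_mulC !mulmxA.
have e2 : mxdot v (W *m S *m W) = \tr (F *m X *m F^T).
  rewrite /mxdot sv WZ /X /F /S trmx_mul !mulmxA.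
  by do 4 rewrite [RHS]mxtrace_mulC !mulmxA.
(* The equation for [v], paired with [v] itself. *)
have linD : D = - \tr X + \tr (F *m X *m F^T) - rho * mxdot v (Sg - Th).
  rewrite -eD (_ : rho *: v + _ = (-1) *: (W + (-1) *: (W *m S *m W) + rho *: (Sg - Th))); last first.
    by rewrite !scaleN1r.
  rewrite mxdotZr !mxdotDr !mxdotZr -e1 -e2; ring.
have D_ge0 : 0 <= D by rewrite addr_ge0 ?mulr_ge0 ?sqnorm_ge0 ?ltW.
(* Young's inequality on the three terms of [linD] leaves [D / 2] on the right, which is
   absorbed. *)
have leD : D <= 2 * n%:R + 2 * tau ^+ 2 + rho * d.
  have h1 : - \tr X <= n%:R + 4^-1 * sqnorm X.
    have := @mxdot_le R n n 1 1%:M ((-1) *: X) ltr01.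
    rewrite mxdotZr sqnorm1 /mxdot trmx1 mul1mx !mulr1 mul1r.
    have := sqnormD (-1) 0 X.
    by rewrite add0r /sqnorm /mxdot trmx0 !mul0mx mxtrace0 => ->; lra.
  have h2 : \tr (F *m X *m F^T) <= tau ^+ 2 + 4^-1 * sqnorm X.
    have -> : \tr (F *m X *m F^T) = mxdot (F^T *m F) X.
      by rewrite /mxdot [(F^T *m F)^T]trmx_mul trmxK mxtrace_mulC mulmxA.
    have := @mxdot_le R n n 1 (F^T *m F) X ltr01.
    have := sqnormM F^T F; rewrite sqnorm_tr -tauF -expr2; lra.
  have h3 : - mxdot v (Sg - Th) <= 2^-1 * d + 2^-1 * sqnorm v.
    have := sqnorm_ge0 (v + 1 *: (Sg - Th)); rewrite sqnormD; rewrite /d; lra.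
  have := ler_wpM2l (ltW rho0) h3; rewrite mulrN linD => h3'.
  have : D <= 2^-1 * (2 * n%:R + 2 * tau ^+ 2 + rho * d) + 2^-1 * D.
    by rewrite {1}linD /D; lra.
  by rewrite -linD; lra.
have hX : eta ^+ 2 * sqnorm X <= 4^-1.
  apply: le_trans he1; apply: ler_wpM2l; first exact: sqr_ge0.
  apply: le_trans leD; rewrite /D lerDr mulr_ge0 ?sqnorm_ge0 //; exact: ltW.
have [pN _] := pdmx_near1 sX hX.
set N := 1%:M + eta *: X in pN.
have uN := pdmx_unit pN.
have BZ : Z *m B = 1%:M by rewrite mulVmx.
(* Congruence by [B] reduces the move from [Sg] to a perturbation [N] of the identity. *)
have SgN : Sg + eta *: v = B^T *m N *m B.
  rewrite /N mulmxDr mulmxDl mulmx1 -SgB; congr (_ + _).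
  rewrite -scalemxAr -scalemxAl /X -!mulmxA BZ mulmx1 mulmxA -trmx_mul BZ.
  by rewrite trmx1 mul1mx.
have pSN : pdmx (Sg + eta *: v).
  by rewrite SgN; apply: pdmx_congr => // x; apply: unitmx_inj.
split=> //.
have invN : invmx (Sg + eta *: v) = Z *m invmx N *m Z^T.
  have uS := pdmx_unit pSN.
  apply: (can_inj (mulKmx uS)); rewrite mulmxV // SgN !mulmxA.
  rewrite -[_ *m B *m Z]mulmxA mulmxV // mulmx1 mulmxK //.
  by rewrite -trmx_mul BZ trmx1.
have trN : \tr (invmx (Sg + eta *: v) *m S) = \tr (F *m invmx N *m F^T).
  by rewrite invN /S /F trmx_mul !mulmxA [LHS]mxtrace_mulC !mulmxA.
have [_ _ [dN lN]] := pdmx_gram pN.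
have [_ _ [dS _]] := pdmx_gram pSg.
have lnN : ln (\det (Sg + eta *: v)) = ln (\det Sg) + ln (\det N).
  rewrite -lnM ?posrE // SgN SgB !det_mulmx; congr (ln _); ring.
have trNE : \tr N - n%:R = eta * \tr X.
  by rewrite /N mxtraceD mxtrace1 mxtraceZ addrC addKr.
have := mxtrace_inv_near1_le F sX hX; rewrite -/N -trN -tauF => htr.
have FX : sqnorm (F *m X) <= tau * sqnorm X by rewrite tauF sqnormM.
have -> : Sg + eta *: v - Th = (Sg - Th) + eta *: v by rewrite addrAC.
rewrite sqnormD -/d /loglik lnN -/tau mxdotC.
(* The second-order terms use up at most half of the first-order decrease [eta D], by the second
   condition on [eta]. *)
have hq : 2 * eta ^+ 2 * sqnorm (F *m X) + rho / 2 * (eta ^+ 2 * sqnorm v) <= eta * (eta * (2 * tau + 1) * D).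
  have h0 : eta ^+ 2 * sqnorm (F *m X) <= eta ^+ 2 * (tau * sqnorm X).
    by apply: ler_wpM2l => //; exact: sqr_ge0.
  have h4 : 0 <= eta ^+ 2 * (tau * (rho * sqnorm v)).
    by rewrite mulr_ge0 ?sqr_ge0 // mulr_ge0 // mulr_ge0 ?sqnorm_ge0 // ltW.
  have h5 : 0 <= eta ^+ 2 * sqnorm X by rewrite mulr_ge0 ?sqr_ge0 ?sqnorm_ge0.
  have h6 : 0 <= eta ^+ 2 * (rho * sqnorm v).
    by rewrite mulr_ge0 ?sqr_ge0 // mulr_ge0 ?sqnorm_ge0 // ltW.
  rewrite /D; lra.
have hq2 : eta * (eta * (2 * tau + 1) * D) <= eta * (2^-1 * D).
  by apply: ler_wpM2l => //; apply: ler_wpM2r.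
have hv : eta * (rho * sqnorm v) <= eta * D.
  by apply: ler_wpM2l => //; rewrite /D lerDl sqnorm_ge0.
have : eta * D = eta * (- \tr X + \tr (F *m X *m F^T) - rho * mxdot v (Sg - Th)).
  by rewrite -linD.
lra.
Qed.
End Descent.

(** * Sublevel sets *)

Section Level.
Variable R : realType.

Lemma norm_det_le n (A : 'M[R]_n) K :
  (forall i j, `|A i j| <= K) -> `|\det A| <= n`!%:R * K ^+ n.
Proof.
move=> hA; rewrite /determinant.
apply: le_trans (ler_norm_sum _ _ _) _.
have -> : n`!%:R * K ^+ n = \sum_(s : {perm 'I_n}) K ^+ n.
  by rewrite sumr_const card_Sn mulr_natl.
apply: ler_sum => s _; rewrite normrM normrX normrN1 expr1n mul1r normr_prod.
rewrite -[n in K ^+ n]card_ord -prodr_const.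
by apply: ler_prod => i _; rewrite normr_ge0 hA.
Qed.

(** The entries of the adjugate are signed minors. Together with a lower bound on the determinant
    this bounds an inverse without eigenvalues. *)
Lemma sqnorm_adj_le n (T : R) :
  exists M, forall A : 'M[R]_n, sqnorm A <= T -> sqnorm (\adj A) <= M.
Proof.
exists (\sum_(i < n) \sum_(j < n) ((n.-1)`!%:R * (1 + T) ^+ n.-1) ^+ 2).
move=> A hA; rewrite sqnormE; apply: ler_sum => i _; apply: ler_sum => j _.
rewrite mxE /cofactor -[leLHS]real_normK ?num_real // lerXn2r ?nnegrE //.
  have T0 : 0 <= T by apply: le_trans hA; exact: sqnorm_ge0.
  by rewrite mulr_ge0 ?exprn_ge0 //; lra.
rewrite normrM normrX normrN1 expr1n mul1r; apply: norm_det_le => k l.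
rewrite !mxE; set x := A _ _.
have : `|x| ^+ 2 <= T by rewrite real_normK ?num_real // (le_trans (sqr_entry_le_sqnorm _ _ _)).
have := normr_ge0 x; nra.
Qed.

(* With [S = E^T E] and [W = E A^-1 E^T], the Gaussian loss is
   [ln (det S) - ln (det W) + tr W], and the bound [ln (det W') <= tr W' - n]
   applied to [W' = W] and [W' = W / 2] controls everything. *)
Lemma loglik_sublevel n (E : 'M[R]_n) c : E \in unitmx ->
  exists M, 0 < M /\ forall A, pdmx A -> loglik (E^T *m E) A <= c ->
    [/\ 0 <= \tr (invmx A *m (E^T *m E)) <= M, sqnorm A <= M,
        ln (\det (E^T *m E)) + n%:R <= loglik (E^T *m E) A &
        forall x : 'cV_n, sqnorm x <= M * (x^T *m A *m x) 0 0].
Proof.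
move=> uE; pose S := E^T *m E; pose l := ln (\det S).
pose L : R := n%:R * ln 2^-1.
(* Bound on [tr W]: the inequality for [W / 2] makes the loss at least [l + n + L + tr W / 2]. *)
pose T : R := 2 * (c - l - n%:R - L).
have [Ma hMa] := sqnorm_adj_le n (T ^+ 2).
(* Lower bound on [det W], as the loss is at least [l - ln (det W)]. *)
pose d := expR (l - c).
pose V := invmx E.
(* [m1] will bound [A = E^T W^-1 E] and [m2] will bound [Z = E^-1 F]. Absolute values keep [M]
   positive even if the sublevel set is empty. *)
pose m1 := sqnorm E ^+ 2 * (d^-1 ^+ 2 * `|Ma|); pose m2 := sqnorm V * `|T|.
pose M : R := 1 + `|T| + m1 + m2.
have t1 := normr_ge0 T.
have t2 : 0 <= m1.
  by rewrite /m1 mulr_ge0 ?sqr_ge0 // mulr_ge0 ?sqr_ge0.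
have t3 : 0 <= m2 by rewrite mulr_ge0 ?sqnorm_ge0.
exists M; split; first by rewrite /M; lra.
move=> A pA hA.
have [B uB AB] := pdmx_gram_unit pA.
pose Z := invmx B; pose F := E *m Z.
have uZ : Z \in unitmx by rewrite unitmx_inv.
have uF : F \in unitmx by rewrite unitmx_mul uE.
have iA : invmx A = Z *m Z^T by rewrite AB invmx_gram.
pose W := F *m F^T.
have p1 : pdmx (1%:M : 'M[R]_n).
  split; first by rewrite /symmx trmx1.
  by move=> x /sqnorm_gt0; rewrite mulmx1 sqnorm_cV.
have injF (x : 'cV[R]_n) : x != 0 -> F^T *m x != 0.
  by apply: unitmx_inj; rewrite unitmx_tr.
have pW : pdmx W.
  by have := pdmx_congr p1 injF; rewrite trmxK mulmx1.
have pW2 : pdmx (2^-1 *: W).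
  split; first by rewrite /symmx trmxZ pW.1.
  by move=> x /pW.2 xx; rewrite -scalemxAr -scalemxAl mxE mulr_gt0 //; lra.
have trW : \tr W = sqnorm F by rewrite -sqnorm_tr /sqnorm /mxdot trmxK.
have tauE : \tr (invmx A *m S) = sqnorm F.
  by rewrite iA /S /sqnorm /mxdot /F trmx_mul !mulmxA [RHS]mxtrace_mulC !mulmxA.
have [_ _ [dA _]] := pdmx_gram pA.
have [_ _ [dW lW]] := pdmx_gram pW.
have [_ _ [dW2 lW2]] := pdmx_gram pW2.
have dS : \det S = \det W * \det A.
  rewrite /W /F AB /S !det_mulmx !det_tr !det_mulmx det_inv; field.
  by move: uB; rewrite unitmxE unitfE.
have lS : l = ln (\det W) + ln (\det A) by rewrite /l dS lnM.
have lhE : loglik S A = l - ln (\det W) + sqnorm F.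
  by rewrite /loglik tauE lS; ring.
rewrite -/S lhE in hA *.
move: lW2; rewrite detZ mxtraceZ trW lnM ?posrE ?exprn_gt0 ?invr_gt0 //.
rewrite lnXn ?invr_gt0 // -[ln _ *+ n]mulr_natl -/L => lW2.
rewrite trW in lW.
have F0 := sqnorm_ge0 F.
have FT : sqnorm F <= T by rewrite /T; lra.
have T0 : 0 <= T by lra.
have TT : `|T| = T by rewrite ger0_norm.
have ZE : Z = V *m F by rewrite /F mulKmx.
have ZM : sqnorm Z <= m2.
  rewrite ZE /m2 TT; apply: le_trans (sqnormM _ _) _.
  by apply: ler_wpM2l => //; exact: sqnorm_ge0.
split.
- by rewrite tauE /M; apply/andP; split; lra.
- have uW := pdmx_unit pW.
  have AW : A = E^T *m invmx W *m E.
    have -> : invmx W = V^T *m A *m V.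
      apply: (can_inj (mulKmx uW)); rewrite mulmxV // /W /F AB trmx_mul !mulmxA.
      rewrite -[_ *m E^T *m V^T]mulmxA -trmx_mul mulVmx // trmx1 mulmx1.
      rewrite -[_ *m Z^T *m B^T]mulmxA -trmx_mul mulmxV // trmx1 mulmx1.
      by rewrite -[_ *m Z *m B]mulmxA mulVmx // mulmx1 mulmxV.
    rewrite !mulmxA -trmx_mul mulVmx // trmx1 mul1mx -mulmxA mulVmx //.
    by rewrite mulmx1.
  have hd : d <= \det W by rewrite -[\det W]lnK ?posrE // ler_expR; lra.
  have d0 : 0 < d by exact: expR_gt0.
  have hadj : sqnorm (\adj W) <= `|Ma|.
    apply: le_trans (ler_norm _); apply: hMa; rewrite /W.
    apply: le_trans (sqnormM _ _) _; rewrite sqnorm_tr expr2.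
    by apply: ler_pM.
  have hW : sqnorm (invmx W) <= d^-1 ^+ 2 * `|Ma|.
    rewrite /invmx uW; have := sqnormD (\det W)^-1 0 (\adj W).
    rewrite add0r => ->; rewrite {1}/sqnorm /mxdot trmx0 !mul0mx mxtrace0 mulr0 !add0r.
    apply: ler_pM; rewrite ?sqr_ge0 ?sqnorm_ge0 // lerXn2r ?nnegrE ?invr_ge0 ?(ltW dW) ?(ltW d0) //.
    by rewrite lef_pV2 ?posrE.
  apply: (@le_trans _ _ m1); last by rewrite /M; lra.
  rewrite {1}AW; apply: le_trans (sqnormM _ _) _.
  rewrite /m1 expr2 mulrAC; apply: ler_wpM2r; first exact: sqnorm_ge0.
  apply: le_trans (sqnormM _ _) _; rewrite sqnorm_tr.
  by apply: ler_wpM2l => //; exact: sqnorm_ge0.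
- rewrite -/l; lra.
- move=> x; have -> : (x^T *m A *m x) 0 0 = sqnorm (B *m x).
    by rewrite sqnorm_cV AB trmx_mul !mulmxA.
  have xE : x = Z *m (B *m x) by rewrite mulKmx.
  rewrite {1}xE; apply: le_trans (sqnormM _ _) _.
  apply: ler_wpM2r; first exact: sqnorm_ge0.
  by apply: le_trans ZM _; rewrite /M; lra.
Qed.
End Level.

(** * Projections onto sparse matrices and one step of the algorithm *)

Section Proj.
Variables (R : realType) (p : nat).
Implicit Types (A B C D Sg Th : 'M[R]_p) (T : {set 'I_p * 'I_p}).

Definition mxsupp A : {set 'I_p * 'I_p} := [set ij | A ij.1 ij.2 != 0]%SET.
Definition mxmask T A : 'M[R]_p :=
  \matrix_(i, j) if (i, j) \in T then A i j else 0.

(* The set counted by [nnz] is a classical set, not a [{set _}]. *)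
Lemma nnzE A : nnz A = #|mxsupp A|.
Proof.
apply: eq_card => ij; rewrite [RHS]inE; apply/idP/idP => [/set_mem//|h].
exact: mem_set.
Qed.

Lemma fdist_le A B C D : (fdist A B <= fdist C D) = (sqnorm (A - B) <= sqnorm (C - D)).
Proof. by rewrite /fdist !frobE ler_sqrt ?sqnorm_ge0. Qed.

Lemma sqr_fdist A B : fdist A B ^+ 2 = sqnorm (A - B).
Proof. by rewrite /fdist frobE sqr_sqrtr ?sqnorm_ge0. Qed.

Lemma fdist_ge0 A B : 0 <= fdist A B.
Proof. by rewrite /fdist frobE sqrtr_ge0. Qed.

Lemma nnz_mxmask T A : (nnz (mxmask T A) <= #|T|)%N.
Proof.
rewrite nnzE; apply: subset_leq_card; apply/fintype.subsetP => -[i j].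
by rewrite inE mxE /=; case: ifP => //; rewrite eqxx.
Qed.

(* A projection only erases entries, so it belongs to a finite family of linear
   images of the projected matrix; this replaces compactness arguments. *)
Lemma projC_mxmask k Sg Th : symmx Sg -> projC k Sg Th -> Th = mxmask (mxsupp Th) Sg.
Proof.
move=> sS [[sT nT] minT]; set A := mxmask _ _.
have suppC i j : ((j, i) \in mxsupp Th) = ((i, j) \in mxsupp Th).
  by rewrite !inE /= -{1}sT mxE.
have CA : Cset k A.
  split; last by apply: leq_trans (nnz_mxmask _ _) _; rewrite -nnzE.
  by apply/matrixP => i j; rewrite !mxE suppC -{1}sS mxE.
have := minT _ CA; rewrite fdist_le.
(* Pythagoras: [Sg - A] vanishes on the support of [Th], and [A - Th] vanishes off it. *)
have -> : sqnorm (Sg - Th) = sqnorm (Sg - A) + sqnorm (A - Th).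
  rewrite !sqnormE -big_split /=; apply: eq_bigr => i _.
  rewrite -big_split /=; apply: eq_bigr => j _; rewrite !mxE inE /=.
  by case: eqP => [->|_] /=; ring.
rewrite gerDl => /sqnorm_eq0/eqP; rewrite subr_eq0 => /eqP; exact: esym.
Qed.

Lemma Cset0 k : Cset k (0 : 'M[R]_p).
Proof.
split; first by rewrite /symmx trmx0.
by rewrite nnzE eq_card0 // => ij; rewrite inE mxE eqxx.
Qed.

Lemma distC_ge0 k Sg : 0 <= distC k Sg.
Proof.
apply: lb_le_inf; first by exists (fdist Sg 0), 0 => //; exact: Cset0.
by move=> _ [A _ <-]; exact: fdist_ge0.
Qed.

Lemma distC_le k Sg A : Cset k A -> distC k Sg ^+ 2 <= sqnorm (Sg - A).
Proof.
move=> CA; rewrite -sqr_fdist lerXn2r ?nnegrE ?distC_ge0 ?fdist_ge0 //.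
apply: ge_inf; last by exists A.
by exists 0 => _ [B _ <-]; exact: fdist_ge0.
Qed.

Lemma distC_proj k Sg Th : projC k Sg Th -> distC k Sg ^+ 2 = sqnorm (Sg - Th).
Proof.
move=> [CT minT]; apply/eqP; rewrite eq_le distC_le //=.
rewrite -sqr_fdist lerXn2r ?nnegrE ?distC_ge0 ?fdist_ge0 //.
apply: lb_le_inf; first by exists (fdist Sg Th), Th.
by move=> _ [A CA <-]; exact: minT.
Qed.

Definition hreal S rho k Sg : R := loglik S Sg + rho / 2 * distC k Sg ^+ 2.

Lemma h_rhoE S rho k Sg : pdmx Sg -> h_rho S rho k Sg = (hreal S rho k Sg)%:E.
Proof. by move=> pS; rewrite /h_rho asboolT. Qed.

(** The value [+oo] off the cone turns a finite bound on [h_rho] into a certificate of positive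
    definiteness. *)
Lemma h_rho_le_fin S rho k Sg (c : R) :
  (h_rho S rho k Sg <= c%:E)%E -> pdmx Sg /\ hreal S rho k Sg <= c.
Proof. by rewrite /h_rho; case: ifPn => [/asboolP|//] pS; rewrite lee_fin. Qed.

Lemma loglik_le_hreal S rho k Sg : 0 < rho -> loglik S Sg <= hreal S rho k Sg.
Proof. by move=> r0; rewrite lerDl mulr_ge0 ?sqr_ge0 // divr_ge0 // ltW. Qed.

(* Injectivity makes the solution [Sh] of the matrix equation symmetric. *)
Lemma lyapunov_inj Sg D rho : pdmx Sg -> 0 < rho ->
  rho *: D + invmx Sg *m D *m invmx Sg = 0 -> D = 0.
Proof.
move=> pS rho0 e; have [B uB SB] := pdmx_gram_unit pS.
pose Z := invmx B.
have WZ : invmx Sg = Z *m Z^T by rewrite SB invmx_gram.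
apply: sqnorm_eq0.
have : mxdot D (rho *: D + invmx Sg *m D *m invmx Sg) = 0.
  by rewrite e /mxdot mulmx0 mxtrace0.
rewrite mxdotDr mxdotZr.
have -> : mxdot D (invmx Sg *m D *m invmx Sg) = sqnorm (Z^T *m D *m Z).
  rewrite /sqnorm /mxdot WZ !trmx_mul trmxK !mulmxA.
  by rewrite mxtrace_mulC !mulmxA.
have := sqnorm_ge0 (Z^T *m D *m Z); have := sqnorm_ge0 D; nra.
Qed.

(** The line search does at least as well as one fixed step [eta], which depends on the sublevel set
    but not on the iterate. *)
Lemma alg_step_descent (E : 'M[R]_p) rho k c : E \in unitmx -> 0 < rho ->
  let S := E^T *m E in
  exists2 g, 0 < g & forall Sg Sg', pdmx Sg -> hreal S rho k Sg <= c ->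
    alg_step S rho k Sg Sg' ->
    pdmx Sg' /\ exists Th v,
    [/\ projC k Sg Th, g * sqnorm v <= hreal S rho k Sg - hreal S rho k Sg' &
      rho *: v + invmx Sg *m v *m invmx Sg =
       - (invmx Sg - invmx Sg *m S *m invmx Sg + rho *: (Sg - Th))].
Proof.
move=> uE rho0 S; have [M [M0 hM]] := loglik_sublevel c uE.
have n0 : 0 <= p%:R :> R by exact: ler0n.
have rM : 0 <= rho * M by rewrite mulr_ge0 // ltW.
have M2 : 0 <= M ^+ 2 by exact: sqr_ge0.
(* [K] dominates the factors in both step-size conditions; [eta K = 1/2] and [eta <= 1/2] then give
   both. *)
pose K : R := 1 + 2 * p%:R + 2 * M ^+ 2 + rho * M + 2 * M.
have K1 : 1 <= K by rewrite /K; lra.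
have K0 : 0 < K by lra.
pose eta : R := (2 * K)^-1.
have eta0 : 0 < eta by rewrite invr_gt0; lra.
have etaK : eta * K = 2^-1 by rewrite /eta; field; lra.
have eta1 : eta <= 1 by nra.
exists (eta / 2 * rho); first by rewrite mulr_gt0 // divr_gt0.
move=> Sg Sg' pS hS [Th [Sh [e [pT eqS _ mine ->]]]].
have [/andP[t0 tM] sM _ _] := hM _ pS (le_trans (loglik_le_hreal S k Sg rho0) hS).
set W := invmx Sg in eqS *; set v := Sh - Sg in mine *.
have sW : W^T = W by rewrite /W trmx_inv pS.1.
have uS := pdmx_unit pS.
(* [Sh^T] solves the same equation, whose data are symmetric. *)
have sSh : Sh^T = Sh.
  apply/eqP; rewrite -subr_eq0; apply/eqP; apply: (lyapunov_inj pS rho0); rewrite -/W.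
  rewrite scalerBr mulmxBr mulmxBl addrACA -opprD eqS.
  have -> : rho *: Sh^T + W *m Sh^T *m W = (rho *: Sh + W *m Sh *m W)^T.
    by rewrite [RHS]linearD /= trmxZ !trmx_mul sW mulmxA.
  rewrite eqS [X in X - _]linearD /= trmxZ !trmx_mul sW trmxK pT.1.1 !mulmxA subrr //.
have sv : symmx v by rewrite /symmx /v linearB /= sSh pS.1.
have eqv : rho *: v + W *m v *m W = - (W - W *m S *m W + rho *: (Sg - Th)).
  rewrite /v mulmxBr mulmxBl scalerBr addrACA eqS mulVmx // mul1mx scalerBr.
  by rewrite opprD !opprB [RHS]addrACA [X in X + _ = _]addrC [X in _ = _ + X]addrC.
have d2 := distC_proj pT.
(* The zero matrix lies in the constraint set, so the distance is at most [|Sg|]. *)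
have dM : sqnorm (Sg - Th) <= M.
  by rewrite -d2; apply: le_trans (distC_le Sg (Cset0 k)) _; rewrite subr0.
have dM' := ler_wpM2l (ltW rho0) dM.
have t2 : \tr (W *m S) ^+ 2 <= M ^+ 2 by rewrite lerXn2r ?nnegrE // (le_trans t0).
have [|| pN hN] := @loglik_descent R p Sg v E Th rho eta pS sv rho0 (ltW eta0) eqv.
- rewrite -/W -/S.
  apply: (@le_trans _ _ (eta ^+ 2 * K)).
    by apply: ler_wpM2l; rewrite ?sqr_ge0 // /K; lra.
  rewrite expr2 -mulrA etaK; nra.
- rewrite -/W -/S; apply: (@le_trans _ _ (eta * K)); last by rewrite etaK.
  by apply: ler_wpM2l; rewrite ?(ltW eta0) // /K; lra.
have := mine eta; rewrite (ltW eta0) eta1 (h_rhoE _ _ _ pN) => /(_ isT).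
move=> /h_rho_le_fin[pS' hS'].
split=> //; exists Th, v; split=> //.
(* Majorization: the old projection [Th] is still a competitor at the new point. *)
have dN := ler_wpM2l (ltW rho0) (distC_le (Sg + eta *: v) pT.1).
move: hS' hN; rewrite -/S /hreal d2; lra.
Qed.

End Proj.

(** * Limits *)

Section Limits.
Variable R : realType.

(** Convergence is entrywise: limits are only passed through polynomial expressions, never through
    inverses. *)
Definition mxcvg m n (U : nat -> 'M[R]_(m, n)) (L : 'M[R]_(m, n)) :=
  forall i j, U k i j @[k --> \oo] --> L i j.

Lemma cvgn_sum n (f : 'I_n -> nat -> R) (l : 'I_n -> R) :
  (forall i, f i k @[k --> \oo] --> l i) ->
  \sum_i f i k @[k --> \oo] --> \sum_i l i.
Proof. by move=> fl; apply: cvg_big => [|i _]; [exact: add_continuous|exact: fl]. Qed.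

Section Ops.
Variables (m n q : nat).
Implicit Types (U V : nat -> 'M[R]_(m, n)) (K L : 'M[R]_(m, n)).

Lemma mxcvg_cst L : mxcvg (fun=> L) L.
Proof. by move=> i j; exact: cvg_cst. Qed.

Lemma mxcvg_unique U K L : mxcvg U K -> mxcvg U L -> K = L.
Proof. by move=> UK UL; apply/matrixP => i j; exact: cvg_unique (UK i j) (UL i j). Qed.

Lemma mxcvgD U V K L : mxcvg U K -> mxcvg V L -> mxcvg (fun k => U k + V k) (K + L).
Proof.
move=> UK VL i j; rewrite mxE; under eq_cvg do rewrite mxE.
exact: cvgD.
Qed.

Lemma mxcvgZ a U L : mxcvg U L -> mxcvg (fun k => a *: U k) (a *: L).
Proof.
move=> UL i j; rewrite mxE; under eq_cvg do rewrite mxE.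
by apply: cvgM => //; exact: cvg_cst.
Qed.

Lemma mxcvgN U L : mxcvg U L -> mxcvg (fun k => - U k) (- L).
Proof.
move=> UL i j; rewrite mxE; under eq_cvg do rewrite mxE.
exact: cvgN.
Qed.

Lemma mxcvg_tr U L : mxcvg U L -> mxcvg (fun k => (U k)^T) L^T.
Proof. by move=> UL i j; rewrite mxE; under eq_cvg do rewrite mxE; exact: UL. Qed.

Lemma mxcvg_mul U (V : nat -> 'M[R]_(n, q)) L (K : 'M[R]_(n, q)) :
  mxcvg U L -> mxcvg V K -> mxcvg (fun k => U k *m V k) (L *m K).
Proof.
move=> UL VK i j; rewrite mxE; under eq_cvg do rewrite mxE.
by apply: cvgn_sum => l; exact: cvgM.
Qed.

Lemma cvgn_sqnorm U L : mxcvg U L -> sqnorm (U k) @[k --> \oo] --> sqnorm L.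
Proof.
move=> UL; rewrite sqnormE; under eq_cvg do rewrite sqnormE.
by apply: cvgn_sum => i; apply: cvgn_sum => j; exact: cvgM.
Qed.

Lemma sqnorm_mxcvg U L : sqnorm (U k - L) @[k --> \oo] --> 0 -> mxcvg U L.
Proof.
move=> UL i j; apply/cvgrPdist_lt => e e0; near=> k.
rewrite distrC -(@ltr_pXn2r _ 2) ?nnegrE ?(ltW e0) // real_normK ?num_real //.
have := sqr_entry_le_sqnorm (U k - L) i j; rewrite !mxE; move/le_lt_trans; apply.
by near: k; apply: (cvgr_lt 0) => //; rewrite exprn_gt0.
Unshelve. all: by end_near. Qed.

End Ops.
Arguments mxcvg_cst {m n} L.

Lemma mxcvg_mxmask p T (U : nat -> 'M[R]_p) L :
  mxcvg U L -> mxcvg (fun k => mxmask T (U k)) (mxmask T L).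
Proof.
move=> UL i j; rewrite mxE; under eq_cvg do rewrite mxE.
by case: ifP => _; [exact: UL | exact: cvg_cst].
Qed.

(** With the support fixed, [W] is a linear image of [U] and converges with it; optimality is a
    closed inequality. *)
Lemma projC_limit p k (U W : nat -> 'M[R]_p) L T :
  (forall m, symmx (U m)) -> (forall m, projC k (U m) (W m)) ->
  (forall m, mxsupp (W m) = T) -> mxcvg U L ->
  projC k L (mxmask T L) /\ mxcvg W (mxmask T L).
Proof.
move=> sU pW sW UL.
have WE m : W m = mxmask T (U m) by rewrite -(sW m); apply: projC_mxmask (sU m) (pW m).
have WL : mxcvg W (mxmask T L).
  by move=> i j; under eq_cvg do rewrite WE; exact: mxcvg_mxmask.
split=> //; split; first split.
- apply: mxcvg_unique (mxcvg_tr WL) _ => i j; under eq_cvg do rewrite (pW _).1.1.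
  exact: WL.
- apply: leq_trans (nnz_mxmask _ _) _; rewrite -(sW 0%N) -nnzE; exact: (pW 0%N).1.2.
- move=> A CA; rewrite fdist_le.
  have lT := cvgn_sqnorm (mxcvgD UL (mxcvgN WL)).
  have lA := cvgn_sqnorm (mxcvgD UL (mxcvgN (mxcvg_cst A))).
  apply: (ler_cvg_to lT lA).
  by apply: nearW => m; rewrite -fdist_le; exact: (pW m).2.
Qed.

(** Pigeonhole by contradiction: if every colour fails from some [m] on, the largest such [m]
    contradicts the limit point. [phi] need not increase; [m <= phi m] is enough for limits. *)
Lemma limit_point_subseq p (F : finType) (U : nat -> 'M[R]_p) (c : nat -> F) L :
  seq_limit_point U L ->
  exists T, exists phi : nat -> nat, forall m,
    [/\ (m <= phi m)%N, c (phi m) = T & fdist (U (phi m)) L < m.+1%:R^-1].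
Proof.
move=> UL; apply: contrapT => /forallNP nT.
have {}nT T : exists m : nat, forall n, (m <= n)%N -> c n = T ->
    m.+1%:R^-1 <= fdist (U n) L.
  apply: contrapT => /forallNP h; apply: (nT T).
  suff /choice[phi hphi] : forall m, exists n, [/\ (m <= n)%N, c n = T & fdist (U n) L < m.+1%:R^-1].
    by exists phi.
  move=> m; apply: contrapT => /forallNP h'; apply: (h m) => n mn cn.
  by rewrite leNgt; apply/negP => lt; apply: (h' n).
have [f hf] := choice nT.
pose N := (\max_T f T)%N.
have N0 : 0 < N.+1%:R^-1 :> R by rewrite invr_gt0.
have [n Nn nL] := UL _ N0 N.
have fN : (f (c n) <= N)%N by exact: leq_bigmax.
have := hf _ n (leq_trans fN Nn) erefl.
apply/negP; rewrite -ltNge; apply: lt_le_trans nL _.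
by rewrite lef_pV2 ?posrE // ler_nat.
Qed.

(** [u] decreases and is bounded below, so its successive differences tend to 0 and squeeze [d]. *)
Lemma descent_cvg0 (u d : nat -> R) g b : 0 < g -> (forall n, b <= u n) ->
  (forall n, 0 <= d n) -> (forall n, g * d n <= u n - u n.+1) ->
  d n @[n --> \oo] --> 0.
Proof.
move=> g0 ub d0 du.
have cu : cvgn u.
  apply: nonincreasing_is_cvgn; last by exists b => _ [n _ <-].
  apply/nonincreasing_seqP => n; have := du n; have := mulr_ge0 (ltW g0) (d0 n); lra.
have h : g^-1 * (u n - u n.+1) @[n --> \oo] --> 0.
  rewrite -(mulr0 g^-1) -(subrr (lim (u @ \oo))).
  apply: cvgM; first exact: cvg_cst.
  by apply: cvgB => //; rewrite (cvg_shiftS u).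
apply: squeeze_cvgr (cvg_cst 0) h; apply: nearW => n.
by rewrite d0 /= ler_pdivlMl.
Qed.

End Limits.
Arguments mxcvg_cst {R m n} L.

(** * Boundedness of the iterates and stationarity of their limit points *)

Theorem theorem1 (R : realType) (p : nat) (S : 'M[R]_p) (rho : R) (k : nat)
    (Sig : nat -> 'M[R]_p) :
  (2 <= p)%N ->
  psdmx S ->
  0 < rho ->
  (k <= 'C(p, 2))%N ->
  (forall n, alg_step S rho k (Sig n) (Sig n.+1)) ->
  pdmx (Sig 0%N) ->
  S \in unitmx ->
  [/\ (exists M : R, forall n, frob (Sig n) <= M),
      (forall n, pdmx (Sig n))
    & (forall L, seq_limit_point Sig L -> stationary S rho k L)].
Proof.
move=> _ pS rho0 _ steps p0 uS.
have [E uE SE] := pdmx_gram_unit (psdmx_unit_pdmx pS uS).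
pose u n := hreal S rho k (Sig n).
have [M [M0 hM]] := loglik_sublevel (u 0%N) uE.
have [g g0 hg] := alg_step_descent k (u 0%N) uE rho0.
rewrite -SE in hM hg.
(* The iterates never leave the initial sublevel set, so [g] and [M] serve for all of them. *)
have inv n : pdmx (Sig n) /\ u n <= u 0%N.
  elim: n => [//|n [pn un]].
  have [pn' [Th [v [_ dv _]]]] := hg _ _ pn un (steps n).
  split=> //; apply: le_trans un; rewrite -subr_ge0; apply: le_trans dv.
  by rewrite mulr_ge0 ?sqnorm_ge0 // ltW.
have pd n : pdmx (Sig n) by have [] := inv n.
have lev n : loglik S (Sig n) <= u 0%N.
  exact: le_trans (loglik_le_hreal S k (Sig n) rho0) (inv n).2.
split=> //.
  exists (Num.sqrt M) => n; rewrite frobE ler_sqrt ?(ltW M0) //.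
  by have [] := hM _ (pd n) (lev n).
have /choice[Th hTh] n := (hg _ _ (pd n) (inv n).2 (steps n)).2.
have [v hv] := choice hTh.
have v0 : sqnorm (v n) @[n --> \oo] --> 0.
  apply: (@descent_cvg0 _ u _ g (ln (\det S) + p%:R)) => // n.
  - apply: le_trans (loglik_le_hreal S k (Sig n) rho0).
    by have [] := hM _ (pd n) (lev n).
  - exact: sqnorm_ge0.
  - by have [] := hv n.
move=> L SL.
(* The colour of an index is the support of its projection. *)
have [T [phi hphi]] := limit_point_subseq (fun n => mxsupp (Th n)) SL.
have UL : mxcvg (fun m => Sig (phi m)) L.
  apply: sqnorm_mxcvg.
  apply: squeeze_cvgr (cvg_cst 0) (@cvg_harmonic R); apply: nearW => m.
  have [_ _ hm] := hphi m; rewrite sqnorm_ge0 -sqr_fdist /harmonic /=.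
  have f0 := fdist_ge0 (Sig (phi m)) L.
  have m1 : m.+1%:R^-1 <= 1 :> R by rewrite invf_le1 // ler1n.
  by apply: le_trans (ltW hm); rewrite expr2 ler_piMr // (ltW (lt_le_trans hm m1)).
have phioo : phi @ \oo --> \oo.
  move=> A [N _ NA]; exists N => // m Nm; apply: NA.
  by apply: leq_trans Nm _; have [] := hphi m.
have vL : mxcvg (fun m => v (phi m)) 0.
  apply: sqnorm_mxcvg; under eq_cvg do rewrite subr0.
  exact: cvg_comp phioo v0.
have pdL : pdmx L.
  split.
    apply: mxcvg_unique (mxcvg_tr UL) _ => i j.
    by under eq_cvg do rewrite (pd _).1; exact: UL.
  (* The uniform bound [|x|^2 <= M x^T Sig_n x] survives in the limit and keeps [L] off the boundary
     of the cone. *)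
  move=> x /sqnorm_gt0 x0; rewrite -(pmulr_rgt0 _ M0); apply: lt_le_trans x0 _.
  have /(_ 0 0) h := mxcvg_mul (mxcvg_mul (mxcvg_cst x^T) UL) (mxcvg_cst x).
  apply: (ler_cvg_to (cvg_cst (sqnorm x)) (cvgM (cvg_cst M) h)).
  by apply: nearW => m; have [_ _ _] := hM _ (pd (phi m)) (lev (phi m)); apply.
have pTh n : projC k (Sig n) (Th n) by have [] := hv n.
have sTh m : mxsupp (Th (phi m)) = T by have [] := hphi m.
have [pTL TL] := projC_limit (fun m => (pd (phi m)).1) (fun m => pTh (phi m)) sTh UL.
split=> //; exists (mxmask T L) => //.
(* Multiplying by [Sig n] on both sides clears the inverses; the right side vanishes in the limit
   with [v]. *)
have eqU n : Sig n - S + rho *: (Sig n *m (Sig n - Th n) *m Sig n) =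
   - (rho *: (Sig n *m v n *m Sig n) + v n).
  have [_ _ e] := hv n; have uU := pdmx_unit (pd n).
  have := congr1 (fun A => - (Sig n *m A *m Sig n)) e.
  rewrite mulmxN mulNmx opprK !mulmxDr !mulmxDl -!scalemxAr -!scalemxAl.
  rewrite mulmxN mulNmx !mulmxA mulmxV // !mul1mx !mulmxKV // => ->.
  by rewrite !mulmxDr !mulmxDl.
have lhs := mxcvgD (mxcvgD UL (mxcvgN (mxcvg_cst S)))
  (mxcvgZ (a := rho) (mxcvg_mul (mxcvg_mul UL (mxcvgD UL (mxcvgN TL))) UL)).
have rhs := mxcvgN (mxcvgD (mxcvgZ (a := rho) (mxcvg_mul (mxcvg_mul UL vL) UL)) vL).
have eqL : L - S + rho *: (L *m (L - mxmask T L) *m L) = 0.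
  have -> : 0 = - (rho *: (L *m 0 *m L) + 0) :> 'M[R]_p.
    by rewrite mulmx0 mul0mx scaler0 addr0 oppr0.
  by apply: mxcvg_unique rhs => i j; under eq_cvg do rewrite -eqU; exact: lhs.
have uL := pdmx_unit pdL.
(* Multiplying back by [L^-1] on both sides gives the stationarity equation. *)
have := congr1 (fun A => invmx L *m A *m invmx L) eqL.
rewrite mulmx0 mul0mx mulmxDr mulmxBr !mulmxDl mulNmx -scalemxAr -scalemxAl.
by rewrite !mulmxA mulVmx // !mul1mx mulmxK.
Qed.
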